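(* Let $p$ be a prime with $p \equiv 1,5,7,11,13,17,19$ or $23 \pmod{24}$, let $\alpha_n=\sum_{k=0}^n\binom{n}{k}^2\binom{n+k}{n}^2$ be the Apéry numbers and let $A_p=\sum_{n=0}^{p-1}\alpha_n t^n\in\mathbb{F}_p[t]$ (coefficients reduced modulo $p$). Then there exists a polynomial $B_p\in\mathbb{F}_p[t]$ such that - if $p\equiv 1,5,7,11\pmod{24}$, then $A_p=B_p^2$; - if $p\equiv 13,17,19,23\pmod{24}$, then $A_p=(t^2-34t+1)\,B_p^2$. *)

(* Defs.v *)
From HB Require Import structures.
From mathcomp Require Import all_boot all_order all_algebra.

Set Implicit Arguments.
Unset Strict Implicit.
Unset Printing Implicit Defensive.

Import GRing.Theory.

Local Open Scope ring_scope.

Definition apery (n : nat) : nat :=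
  (\sum_(0 <= k < n.+1) 'C(n, k) ^ 2 * 'C(n + k, n) ^ 2)%N.

(* For prime p, 'F_p is the field with p elements, and %:R is reduction mod p. *)
Definition apery_poly (p : nat) : {poly 'F_p} :=
  \poly_(n < p) (apery n)%:R.

(* Main.v *)
Require Import Defs.
From HB Require Import structures.
From mathcomp Require Import all_boot all_order all_algebra.
From mathcomp Require Import zify ring.

(* Put t = x / q(x) with q = (1 + 8x)(1 + 9x).  In terms of x, the third order
   Apery equation is the symmetric square of a second order equation, which has
   modulo p a polynomial solution H of degree p - 1 with H(0) = 1, a truncated
   hypergeometric series.  Hence q^(p-1) A_p(x / q) and H^2 solve the same third
   order equation, so they agree up to degree p - 1 as soon as they agree at 0.
   The second order equation is invariant under x -> 1 / (72 x), and therefore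
   H is palindromic or antipalindromic, up to powers of 72.  In the first case
   H = q^((p-1)/2) B(x / q) and A_p = B^2; in the second case 1 - 72 x^2 can be
   factored out of H, and (1 - 72 x^2)^2 = q^2 (t^2 - 34 t + 1) accounts for the
   quadratic factor of A_p.  The sign is that of the leading coefficient of H,
   which is (-3/p) by Chu-Vandermonde, times 72^((p-1)/2) = (2/p). *)

Set Implicit Arguments.
Unset Strict Implicit.
Unset Printing Implicit Defensive.

Import GRing.Theory.

Local Open Scope ring_scope.

(** * Recurrence of the Apery numbers by creative telescoping *)

Section AperyRecurrence.

Variable R : numFieldType.

Definition apery_root (n k : nat) : R := ('C(n, k) * 'C(n + k, n))%:R.

Lemma natf_neq0 (n : nat) : (0 < n)%N -> n%:R != 0 :> R.
Proof. by rewrite Num.Theory.pnatr_eq0 lt0n. Qed.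

Lemma apery_rootE (n k : nat) : (k <= n)%N ->
  apery_root n k = (n + k)`!%:R / ((n - k)`!%:R * k`!%:R ^+ 2).
Proof.
move=> le_kn; apply: (canRL (mulfK _)).
  by rewrite mulf_neq0 ?expf_neq0 ?natf_neq0 ?fact_gt0.
rewrite /apery_root -natrX -!natrM; congr (_%:R).
have := bin_fact le_kn; have := bin_fact (leq_addr k n); rewrite addKn.
by move=> <- <-; lia.
Qed.

(** The common factor [f] reduces the certificate identity to a polynomial identity in [n] and [k].
    When [k] is [n] or [n.+1], the linear factors that vanish match the binomials that vanish. *)
Lemma apery_root_shift (n k : nat) : (k <= n.+1)%N ->
  exists f : R, [/\
    apery_root n.+2 k.+1 = (n%:R + k%:R + 3%:R) * (n%:R + k%:R + 2%:R) * f,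
    apery_root n.+1 k.+1 = (n%:R + k%:R + 2%:R) * (n%:R - k%:R + 1) * f,
    apery_root n k.+1 = (n%:R - k%:R + 1) * (n%:R - k%:R) * f &
    apery_root n.+1 k = (k%:R + 1) ^+ 2 * f].
Proof.
move=> le_k.
exists ((n + k).+1`!%:R / ((n.+1 - k)`!%:R * k.+1`!%:R ^+ 2)).
have f0 m : m`!%:R != 0 :> R by rewrite natf_neq0 ?fact_gt0.
have s0 m : m.+1%:R != 0 :> R by rewrite natf_neq0.
have E (m : nat) : m.+1%:R = m%:R + 1 :> R by rewrite -addn1 natrD.
split.
- rewrite apery_rootE ?ltnS // subSS !addSn !addnS !factS !natrM !E !natrD.
  by field; rewrite !f0 -E s0.
- have [lt_k|] := ltnP k n.+1; last first.
    move=> le_nk; have -> : k = n.+1 by lia.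
    by rewrite /apery_root bin_small // mul0n E; ring.
  rewrite apery_rootE // !addSn !addnS.
  have [j ->] : exists j, n = (k + j)%N by exists (n - k)%N; lia.
  have -> : ((k + j).+1 - k.+1 = j)%N by lia.
  have -> : ((k + j).+1 - k = j.+1)%N by lia.
  rewrite !factS !natrM !E !natrD.
  by field; rewrite !f0 -!E !s0.
- have [lt_k|] := ltnP k n; last first.
    move=> le_nk; have [->|->] : k = n \/ k = n.+1 by lia.
      by rewrite /apery_root bin_small // mul0n; ring.
    by rewrite /apery_root bin_small // mul0n E; ring.
  rewrite apery_rootE // addnS.
  have [j ->] : exists j, n = (k + j).+1 by exists (n - k).-1; lia.
  have -> : ((k + j).+1 - k.+1 = j)%N by lia.
  have -> : ((k + j).+2 - k = j.+2)%N by lia.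
  rewrite !factS !natrM !E !natrD.
  field. rewrite !f0 -!E -?natrD.
  by rewrite !s0.
- rewrite apery_rootE // !addSn !factS !natrM !E.
  by field; rewrite !f0 -!E !s0.
Qed.

(* Zeilberger's certificate for the Apery numbers. *)
Definition apery_cert (n k : nat) : R :=
  4%:R * (2%:R * n%:R + 1) *
  (k%:R * (2%:R * k%:R + 1) - (2%:R * n%:R + 1) ^+ 2) * apery_root n k ^+ 2.

Lemma apery_cert_step (n k : nat) : (k <= n.+1)%N ->
  apery_cert n.+1 k.+1 - apery_cert n.+1 k =
  (n%:R + 2%:R) ^+ 3 * apery_root n.+2 k.+1 ^+ 2
  - (2%:R * n%:R + 3%:R) * (17%:R * n%:R ^+ 2 + 51%:R * n%:R + 39%:R)
    * apery_root n.+1 k.+1 ^+ 2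
  + (n%:R + 1) ^+ 3 * apery_root n k.+1 ^+ 2.
Proof.
move=> /apery_root_shift [f [E1 E2 E3 E4]].
rewrite /apery_cert {}E1 {}E2 {}E3 {}E4; ring.
Qed.

(** Terms with [k > n] vanish, so three consecutive Apery numbers can be summed over one common
    range. *)
Lemma apery_sumE (n m : nat) : (n <= m)%N ->
  (apery n)%:R = \sum_(0 <= k < m.+1) apery_root n k ^+ 2.
Proof.
move=> le_nm; rewrite /apery natr_sum.
rewrite [RHS](big_cat_nat _ (n := n.+1)) //= [X in _ + X]big1_seq ?addr0.
  by apply: eq_bigr => k _; rewrite /apery_root -natrX expnMn.
move=> k; rewrite mem_index_iota => /and3P[_ lt_nk _].
by rewrite /apery_root bin_small // mul0n expr0n.
Qed.

Lemma apery_rec_num (n : nat) :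
  (n%:R + 2%:R) ^+ 3 * (apery n.+2)%:R
  - (2%:R * n%:R + 3%:R) * (17%:R * n%:R ^+ 2 + 51%:R * n%:R + 39%:R)
    * (apery n.+1)%:R
  + (n%:R + 1) ^+ 3 * (apery n)%:R = 0 :> R.
Proof.
rewrite !(apery_sumE (m := n.+2)) // ?leqW //.
rewrite ![\sum_(0 <= k < n.+3) _]big_nat_recl //.
have r0 m : apery_root m 0 = 1 by rewrite /apery_root bin0 addn0 binn.
rewrite !r0 expr1n.
have : \sum_(0 <= k < n.+2)
    ((n%:R + 2%:R) ^+ 3 * apery_root n.+2 k.+1 ^+ 2
     - (2%:R * n%:R + 3%:R) * (17%:R * n%:R ^+ 2 + 51%:R * n%:R + 39%:R)
       * apery_root n.+1 k.+1 ^+ 2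
     + (n%:R + 1) ^+ 3 * apery_root n k.+1 ^+ 2)
    = apery_cert n.+1 n.+2 - apery_cert n.+1 0.
  rewrite -telescope_sumr //; apply: eq_big_nat => k /andP[_ lt_k].
  by rewrite apery_cert_step.
(* The upper boundary term vanishes. The lower one contributes 4 (2n + 3)^3, which cancels the three
   [k = 0] terms split off above. *)
have rS : apery_root n.+1 n.+2 = 0 by rewrite /apery_root bin_small // mul0n.
rewrite big_split sumrB /= -!mulr_sumr /apery_cert r0 rS.
move: (\sum_(_ <= k < _) _) (\sum_(_ <= k < _) _) (\sum_(_ <= k < _) _).
move=> x y z E.
move/eqP: E; rewrite -subr_eq0 => /eqP E; rewrite -[RHS]E.
  ring.
Qed.

End AperyRecurrence.

(** The certificate argument divides by factorials, hence the detour through [rat]. Written without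
    subtraction, the identity lives in [nat] and maps to every ring, in particular to characteristic
    p. *)
Lemma apery_rec (R : pzRingType) (n : nat) :
  n.+2%:R ^+ 3 * (apery n.+2)%:R
  - (2 * n + 3)%:R * (17 * n ^ 2 + 51 * n + 39)%:R * (apery n.+1)%:R
  + n.+1%:R ^+ 3 * (apery n)%:R = 0 :> R.
Proof.
have E : (n.+2 ^ 3 * apery n.+2 + n.+1 ^ 3 * apery n =
  (2 * n + 3) * (17 * n ^ 2 + 51 * n + 39) * apery n.+1)%N.
  apply/eqP; rewrite -(Num.Theory.eqr_nat rat) -subr_eq0 -(apery_rec_num rat n).
  by apply/eqP; rewrite !(natrD, natrM, natrX); ring.
apply/eqP; rewrite addrAC subr_eq0 -!natrX -!natrM -natrD; apply/eqP.
by congr (_%:R).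
Qed.

(** * The derivation [theta] and the symmetric square operator *)

Section Theta.

Variable R : comNzRingType.
Implicit Types f g y : {poly R}.

(* The Apery equation is pulled back along [t = x / quad]; there
   [theta = quad * x * d/dx] equals [(1 - 72 x ^ 2) * t * d/dt], and [sym_op] is
   the symmetric square of [theta ^ 2 + potential]. *)
Definition quad : {poly R} := 1 + 17%:R * 'X + 72%:R * 'X ^+ 2.

Definition theta f := quad * 'X * f^`().

Definition potential : {poly R} := 6%:R * 'X * (1 + 12%:R * 'X) * quad.

Definition sym_op f :=
  theta (theta (theta f)) + 4%:R * potential * theta f
  + 2%:R * theta potential * f.

Lemma theta_is_linear : linear theta.
Proof. by move=> a f g; rewrite /theta derivD derivZ mulrDr scalerAr. Qed.

HB.instance Definition _ :=
  GRing.isLinear.Build R {poly R} {poly R} _ theta theta_is_linear.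

Lemma thetaM f g : theta (f * g) = theta f * g + f * theta g.
Proof. by rewrite /theta derivM; ring. Qed.

Lemma sym_op_is_linear : linear sym_op.
Proof.
move=> a f g; rewrite /sym_op !linearP /=.
by rewrite -!mul_polyC; ring.
Qed.

HB.instance Definition _ :=
  GRing.isLinear.Build R {poly R} {poly R} _ sym_op sym_op_is_linear.

(** With [z = theta y], the derivation maps the span of [y ^ 2], [y * z] and [z ^ 2] to itself, and
    the [z ^ 2] part of the third derivative of [y ^ 2] is zero. *)
Lemma sym_op_sqr y : theta (theta y) = - (potential * y) -> sym_op (y ^+ 2) = 0.
Proof.
move=> E; rewrite /sym_op expr2; set z := theta y in E.
have E1 : theta (y * y) = (y * z) *+ 2 by rewrite thetaM -/z; ring.
have E2 : theta (y * z) = z * z - potential * (y * y).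
  by rewrite thetaM E -/z; ring.
have E4 : theta (potential * (y * y)) =
    theta potential * (y * y) + potential * (y * z) *+ 2.
  by rewrite thetaM E1; ring.
have E3 : theta (z * z) = - (potential * (y * z)) *+ 2.
  by rewrite thetaM E; ring.
rewrite E1 [X in theta X]raddfMn /= E2 raddfMn raddfB /= E3 E4; ring.
Qed.

(** Exponents occurring in [f] enter only through its logarithmic derivative [l], which is what
    makes powers with symbolic exponents tractable. *)
Lemma sym_op_eigen f l : theta f = l * f ->
  sym_op f = (theta (theta l) + 3%:R * l * theta l + l ^+ 3
              + 4%:R * potential * l + 2%:R * theta potential) * f.
Proof.
move=> E; set z := theta l.
have E1 : theta (l * f) = (z + l * l) * f by rewrite thetaM E -/z; ring.
have E2 : theta (z + l * l) = theta z + l * z *+ 2.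
  by rewrite raddfD /= [theta (l * l)]thetaM -/z; ring.
have E3 : theta ((z + l * l) * f) = (theta z + l * z *+ 2 + (z + l * l) * l) * f.
  by rewrite thetaM E E2; ring.
by rewrite /sym_op E E1 E3; ring.
Qed.

Lemma deriv_natr n : (n%:R : {poly R})^`() = 0.
Proof. by rewrite -polyC_natr derivC. Qed.

Lemma mul_deriv_exp f n : f * (f ^+ n)^`() = n%:R * f^`() * f ^+ n.
Proof.
by case: n => [|n]; rewrite deriv_exp ?exprS /=; ring.
Qed.

Lemma deriv_quad : quad^`() = 17%:R + 144%:R * 'X.
Proof.
rewrite /quad !derivD !derivM !deriv_natr (deriv_natr 1) derivX; ring.
Qed.

Lemma coefM_low f g n : (forall i, (i < n)%N -> f`_i = 0) ->
  forall i, (i <= n)%N -> (g * f)`_i = g`_0 * f`_i.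
Proof.
move=> f0 i le_in; rewrite coefM big_ord_recl /= subn0 big1 ?addr0 // => j _.
by rewrite f0 ?mulr0 // /bump /=; have := ltn_ord j; lia.
Qed.

Lemma coef_theta_low f n : (forall i, (i < n)%N -> f`_i = 0) ->
  forall i, (i <= n)%N -> (theta f)`_i = i%:R * f`_i.
Proof.
have E i : ('X * f^`())`_i = i%:R * f`_i.
  by case: i => [|i]; rewrite coefXM ?mul0r //= coef_deriv mulr_natl.
move=> f0 i le_in; rewrite /theta -mulrA (@coefM_low _ _ n) // => [|j lt_jn].
  by rewrite E /quad !coefE /= !(mulr0, addr0, mul1r).
by rewrite E f0 ?mulr0.
Qed.

(** Indicial equation at 0: on the lowest coefficient [theta] acts as multiplication by [n], while
    [potential] and its image under [theta] have no constant term. *)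
Lemma sym_op_coef0 f n : sym_op f = 0 -> (forall i, (i < n)%N -> f`_i = 0) ->
  n%:R ^+ 3 * f`_n = 0.
Proof.
move=> E f0.
have t0 g : (forall i, (i < n)%N -> g`_i = 0) ->
    forall i, (i < n)%N -> (theta g)`_i = 0.
  by move=> g0 i lt_in; rewrite (coef_theta_low g0 (ltnW lt_in)) g0 ?mulr0.
have b0 : potential`_0 = 0 by rewrite /potential -!mulrA mulrCA coefXM.
have tb0 : (theta potential)`_0 = 0 by rewrite (@coef_theta_low _ 0) // mul0r.
have := congr1 (fun g : {poly R} => g`_n) E.
rewrite !coefD coef0 (coef_theta_low (t0 _ (t0 _ f0)) (leqnn n)).
rewrite (coef_theta_low (t0 _ f0) (leqnn n)) (coef_theta_low f0 (leqnn n)).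
rewrite (coefM_low _ (t0 _ f0) (leqnn n)) (coefM_low _ f0 (leqnn n)).
rewrite (coef0M 4%:R) (coef0M 2%:R) b0 tb0 !mulr0 !mul0r !addr0 => En.
by rewrite -[RHS]En; ring.
Qed.

End Theta.

(** Summation by parts: the total coefficient of each interior [V j] is an instance of [apery_rec],
    so only boundary terms survive. Their factor [m.+1] is zero modulo p when m = p - 1. *)
Lemma apery_telescope (R : comPzRingType) (V : nat -> R) (m : nat) :
  \sum_(n < m.+1) (apery n)%:R *
    (n%:R ^+ 3 * V n
     - (2%:R * n%:R + 1) * (17%:R * n%:R ^+ 2 + 17%:R * n%:R + 5%:R) * V n.+1
     + (n%:R + 1) ^+ 3 * V n.+2)
  = m.+1%:R ^+ 3 * ((apery m)%:R * V m.+2 - (apery m.+1)%:R * V m.+1).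
Proof.
elim: m => [|m IHm].
  rewrite big_ord1 /= /apery !big_nat_recl // !big_geq //.
  by rewrite !(bin0, bin1, binn, addn0, addn1); ring.
rewrite big_ord_recr {}IHm /=.
apply/eqP; rewrite -subr_eq0; apply/eqP.
rewrite -[RHS](mulr0 (V m.+2)) -(apery_rec R m) !(natrD, natrM, natrX).
by ring.
Qed.

(** * Pulling the Apery equation back to the variable x *)

Section Homogenization.

Variable R : idomainType.
Implicit Types f g : {poly R}.


Lemma coef0_quad : (quad R)`_0 = 1.
Proof. by rewrite /quad !coefE /= !(mulr0, addr0). Qed.

Lemma quad_neq0 : (quad R) != 0.
Proof.
by apply/eqP => E; have := coef0_quad;
rewrite E coef0 => /esym/eqP; rewrite oner_eq0.
Qed.

(* [homog N f = quad ^ N * f(x / quad)], for [f] of degree at most [N]. *)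
Definition homog N f :=
  \sum_(i < N.+1) f`_i *: ('X^i * quad R ^+ (N - i)).

Lemma homog_is_linear N : linear (homog N).
Proof.
move=> a f g; rewrite /homog scaler_sumr -big_split; apply: eq_bigr => i _ /=.
by rewrite coefD coefZ scalerDl scalerA.
Qed.

HB.instance Definition _ N :=
  GRing.isLinear.Build R {poly R} {poly R} _ (homog N) (homog_is_linear N).

Lemma homogXn N i : (i <= N)%N -> homog N 'X^i = 'X^i * quad R ^+ (N - i).
Proof.
move=> le_iN; rewrite /homog (bigD1 (Ordinal (le_iN : i < N.+1)%N)) //=.
rewrite coefXn eqxx scale1r big1 ?addr0 // => j ne_ji; rewrite coefXn.
by have /negPf -> : val j != i by []; rewrite scale0r.
Qed.

Lemma homogM M N f g : (size f <= M.+1)%N -> (size g <= N.+1)%N ->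
  homog M f * homog N g = homog (M + N) (f * g).
Proof.
have E (h : {poly R}) n : (size h <= n)%N -> h = \sum_(i < n) h`_i *: 'X^i.
  move=> sh; rewrite -poly_def; apply/polyP => i; rewrite coef_poly.
  by case: ltnP => // le_ni; rewrite nth_default ?(leq_trans sh).
move=> sf sg; rewrite [in RHS](E _ _ sf) [in RHS](E _ _ sg).
rewrite [in RHS]big_distrlr linear_sum /homog big_distrlr /=.
apply: eq_bigr => i _; rewrite -/(homog _ _) linear_sum.
apply: eq_bigr => j _; rewrite -scalerAl -scalerAr -scalerAl -scalerAr.
rewrite !linearZ /= -exprD homogXn; last first.
  by have := ltn_ord i; have := ltn_ord j; lia.
have -> : (M + N - (i + j) = (M - i) + (N - j))%N.
  by have := ltn_ord i; have := ltn_ord j; lia.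
by rewrite !exprD !scalerA mulrC; congr (_ *: _); ring.
Qed.

Lemma coef_homog_low N f n : (n <= N)%N ->
  (forall i, (i < n)%N -> f`_i = 0) ->
  forall i, (i <= n)%N -> (homog N f)`_i = f`_i.
Proof.
move=> le_nN f0 i le_in; rewrite /homog coef_sum.
have lt_iN : (i < N.+1)%N by lia.
rewrite (bigD1 (Ordinal lt_iN)) //= big1 ?addr0 => [|j ne_ji].
  rewrite coefZ coefXnM ltnn subnn -horner_coef0 horner_exp horner_coef0.
  by rewrite coef0_quad expr1n mulr1.
rewrite coefZ coefXnM; case: ltnP => le_ij; first by rewrite mulr0.
by rewrite f0 ?mul0r //; move: ne_ji; rewrite -val_eqE /=; lia.
Qed.

(** [homog] preserves the lowest coefficient because [quad] has constant term 1, so the indicial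
    equation kills the coefficients of [f] one after the other, as long as [n] is invertible. *)
Lemma homog_sym_op_eq0 N f : (forall n, (0 < n <= N)%N -> n%:R != 0 :> R) ->
  f`_0 = 0 -> sym_op (homog N f) = 0 -> forall n, (n <= N)%N -> f`_n = 0.
Proof.
move=> N0 f00 E; elim/ltn_ind => n IHn le_nN.
have f0 i : (i < n)%N -> f`_i = 0 by move=> lt_in; apply: IHn => //; lia.
case: n => // n in IHn le_nN f0 *.
have coefE := coef_homog_low le_nN f0.
have h0 i : (i < n.+1)%N -> (homog N f)`_i = 0.
  by move=> lt_in; rewrite coefE ?f0 // ltnW.
have /eqP := sym_op_coef0 E h0.
by rewrite coefE // mulf_eq0 expf_eq0 /= (negPf (N0 _ _)) // => /eqP.
Qed.

(** As [N.+1] is zero in [R], the exponent [N - n] acts as -1 - n under derivation: the polynomial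
    behaves like t^n / [quad] with t = x / [quad]. *)
Lemma theta_monomial N n : N.+1%:R = 0 :> R -> (n <= N)%N ->
  theta ('X^n * quad R ^+ (N - n)) =
  (n%:R * (1 - 72%:R * 'X ^+ 2) - (17%:R * 'X + 144%:R * 'X ^+ 2))
  * ('X^n * quad R ^+ (N - n)).
Proof.
move=> N1 le_nN; rewrite /theta derivM.
have Nn : (N - n)%:R = - 1 - n%:R :> {poly R}.
  have : N.+1%:R = 0 :> {poly R} by rewrite -polyC_natr N1.
  by rewrite -{1}(subnK le_nN) -addn1 !natrD => E; rewrite -[RHS]addr0 -E; ring.
have Ex := mul_deriv_exp ('X : {poly R}) n; rewrite derivX mulr1 in Ex.
have Eq := mul_deriv_exp (quad R) (N - n); rewrite deriv_quad Nn in Eq.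
transitivity ((quad R) * ('X * 'X^n^`()) * quad R ^+ (N - n)
   + 'X * 'X^n * ((quad R) * (quad R ^+ (N - n))^`())); first by ring.
by rewrite Ex Eq /quad; ring.
Qed.

Lemma theta_quadratic f g h : f^`() = 0 -> g^`() = 0 -> h^`() = 0 ->
  theta (f + g * 'X + h * 'X ^+ 2) = quad R * 'X * (g + 2%:R * h * 'X).
Proof.
move=> f0 g0 h0; rewrite /theta !derivD !derivM f0 g0 h0 derivX.
by congr (_ * _); ring.
Qed.

(** Up to [quad ^ 2], the middle factor is n^3 - (2n + 1)(17n^2 + 17n + 5) t + (n + 1)^3 t^2, the
    action of the Apery operator on t^n. *)
Lemma sym_op_monomial N n : N.+1%:R = 0 :> R -> (n <= N)%N ->
  sym_op ('X^n * quad R ^+ (N - n)) =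
  (1 - 72%:R * 'X ^+ 2) *
  (n%:R ^+ 3 * quad R ^+ 2
   - (2%:R * n%:R + 1) * (17%:R * n%:R ^+ 2 + 17%:R * n%:R + 5%:R) * 'X * quad R
   + (n%:R + 1) ^+ 3 * 'X ^+ 2)
  * ('X^n * quad R ^+ (N - n)).
Proof.
move=> N1 le_nN; rewrite (sym_op_eigen (theta_monomial N1 le_nN)); congr (_ * _).
have dn m : (- m%:R : {poly R})^`() = 0 by rewrite derivN deriv_natr oppr0.
set l := _ - _; set m := (72 * n + 144)%N; set k := (2 * m)%N.
have El : l = n%:R + - 17%:R * 'X + - m%:R * 'X ^+ 2.
  by rewrite /l /m natrD natrM; ring.
have E1 : theta l = (0 + - 17%:R * 'X + - k%:R * 'X ^+ 2) * quad R.
  by rewrite El theta_quadratic ?deriv_natr ?dn // /k natrM; ring.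
have E2 : theta (theta l) = quad R * 'X * (- 17%:R + 2%:R * - k%:R * 'X) * quad R
    + (0 + - 17%:R * 'X + - k%:R * 'X ^+ 2)
      * (quad R * 'X * (17%:R + 144%:R * 'X)).
  by rewrite E1 thetaM theta_quadratic ?deriv0 ?dn // /theta deriv_quad.
have E3 : theta (potential R) = quad R * 'X * (6%:R + 2%:R * 72%:R * 'X) * quad R
    + (0 + 6%:R * 'X + 72%:R * 'X ^+ 2) * (quad R * 'X * (17%:R + 144%:R * 'X)).
  have -> : potential R = (0 + 6%:R * 'X + 72%:R * 'X ^+ 2) * quad R.
    by rewrite /potential; ring.
  by rewrite thetaM theta_quadratic ?deriv0 ?deriv_natr // /theta deriv_quad.
rewrite E2 E3 E1 /l /k /m /potential /quad !(natrM, natrD).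
ring.
Qed.

Lemma sym_op_apery N : N.+1%:R = 0 :> R ->
  sym_op (homog N (\poly_(n < N.+1) (apery n)%:R)) = 0.
Proof.
move=> N1; pose V j : {poly R} := 'X^j * quad R ^+ (N.+1 - j).
apply: (mulfI quad_neq0); rewrite mulr0 /homog linear_sum mulr_sumr /=.
have N1' : N.+1%:R = 0 :> {poly R} by rewrite -polyC_natr N1.
have := apery_telescope V N; rewrite N1' expr0n mul0r.
move/(congr1 ( *%R ((1 - 72%:R * 'X ^+ 2) * quad R ^+ 2))); rewrite mulr0 => E0.
rewrite -[RHS]E0 [RHS]mulr_sumr; apply: eq_bigr => n _.
have le_nN : (n <= N)%N by rewrite -ltnS.
rewrite coef_poly ltn_ord linearZ /= sym_op_monomial // scaler_nat -mulr_natl.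
have -> : V n = (quad R) * ('X^n * quad R ^+ (N - n)).
  by rewrite /V subSn // exprS; ring.
have -> : V n.+1 = 'X * ('X^n * quad R ^+ (N - n)).
  by rewrite /V subSS exprS; ring.
(* For [n = N] the truncated exponent in [V n.+2] is wrong, but its coefficient (N + 1)^3 is
   zero. *)
have : (n%:R + 1) ^+ 3 * V n.+2 * quad R =
   (n%:R + 1) ^+ 3 * 'X ^+ 2 * ('X^n * quad R ^+ (N - n)).
  have [lt_nN|] := ltnP n N; last first.
    move=> le_Nn.
    have -> : nat_of_ord n = N by apply/eqP; rewrite eqn_leq le_nN.
    by rewrite natr1 N1' expr0n !mul0r.
  rewrite /V -(subnSK lt_nN) !exprS subSS; ring.
move: ('X^n * _) (V n.+2) => v w E.
set c := (2%:R * _ + 1) * _.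
transitivity ((1 - 72%:R * 'X ^+ 2) * quad R * (apery n)%:R *
    (n%:R ^+ 3 * quad R ^+ 2 * v - c * 'X * quad R * v
     + (n%:R + 1) ^+ 3 * 'X ^+ 2 * v)); first by ring.
by rewrite -E; ring.
Qed.

End Homogenization.

(** * Palindromic polynomials as polynomials in x / [quad] *)

Section Palindromes.

Variable R : idomainType.
Implicit Types f g : {poly R}.

Definition is_homog N f :=
  exists2 g : {poly R}, (size g <= N.+1)%N & f = homog N g.

Lemma is_homogD N f g : is_homog N f -> is_homog N g -> is_homog N (f + g).
Proof.
move=> [f' sf ->] [g' sg ->]; exists (f' + g'); last by rewrite linearD.
by rewrite (leq_trans (size_polyD _ _)) // geq_max sf.
Qed.

Lemma is_homogZ N a f : is_homog N f -> is_homog N (a *: f).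
Proof.
move=> [g sg ->]; exists (a *: g); last by rewrite linearZ.
exact: leq_trans (size_scale_leq _ _) sg.
Qed.

Lemma is_homogM M N f g :
  is_homog M f -> is_homog N g -> is_homog (M + N) (f * g).
Proof.
move=> [f' sf ->] [g' sg ->]; exists (f' * g'); last by rewrite homogM.
by rewrite (leq_trans (size_polyMleq _ _)) //; lia.
Qed.

Lemma is_homogXn N : is_homog N 'X^N.
Proof.
by exists 'X^N; rewrite ?size_polyXn // homogXn // subnn mulr1.
Qed.

Lemma is_homog_sum (I : Type) (r : seq I) (P : pred I) N (F : I -> {poly R}) :
  (forall i, P i -> is_homog N (F i)) -> is_homog N (\sum_(i <- r | P i) F i).
Proof.
move=> HF; elim/big_ind: _ => //; last by move=> f g; apply: is_homogD.
by exists 0; rewrite ?size_poly0 // linear0.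
Qed.

(** The witness is 1 - 17t, since 1 + 72x^2 = [quad] - 17x. *)
Lemma is_homog_1D72X2 : is_homog 1 (1 + 72%:R *: 'X^2).
Proof.
exists (1 + (- 17%:R) *: 'X^1).
  rewrite (leq_trans (size_polyD _ _)) // geq_max size_poly1.
  by rewrite (leq_trans (size_scale_leq _ _)) // size_polyXn.
rewrite linearD linearZ /= -[1 in RHS](expr0 'X) !homogXn // /quad.
by rewrite -!mul_polyC polyCN !polyC_natr; ring.
Qed.

(* [1 + y ^ k] and [1 + y + ... + y ^ k], for [y = 72 x^2], both satisfy
   this recurrence. *)
Lemma is_homog_chebyshev (F : nat -> {poly R}) :
  is_homog 0 (F 0) -> is_homog 1 (F 1) ->
  (forall k, F k.+2 =
    (1 + 72%:R *: 'X^2) * F k.+1 - 72%:R *: 'X^2 * F k) ->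
  forall k, is_homog k (F k).
Proof.
move=> F0 F1 FS k; suff [] : is_homog k (F k) /\ is_homog k.+1 (F k.+1) by [].
elim: k => // k [IH1 IH2]; split=> //; rewrite FS; apply: is_homogD.
  by rewrite -[k.+2]add1n; apply: is_homogM => //; apply: is_homog_1D72X2.
rewrite -mulNr -scaleNr -[k.+2]add2n; apply: is_homogM => //.
exact/is_homogZ/is_homogXn.
Qed.

Lemma is_homog_1Dexp k : is_homog k (1 + (72%:R *: 'X^2) ^+ k).
Proof.
apply: (@is_homog_chebyshev (fun k => 1 + (72%:R *: 'X^2) ^+ k)) => [||j].
- by apply: is_homogD; apply: (is_homogXn 0).
- exact: is_homog_1D72X2.
- by rewrite !exprS; ring.
Qed.

Lemma is_homog_geometric k : is_homog k (\sum_(i < k.+1) (72%:R *: 'X^2) ^+ i).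
Proof.
apply: (@is_homog_chebyshev (fun k => \sum_(i < k.+1) (72%:R *: 'X^2) ^+ i)).
- by rewrite big_ord1; apply: (is_homogXn 0).
- by rewrite !big_ord_recr big_ord0 /= add0r; apply: is_homog_1D72X2.
- by move=> j; rewrite !big_ord_recr /= !exprS; ring.
Qed.

Lemma sum_fold (V : nmodType) (F : nat -> V) N :
  \sum_(i < N.*2.+1) F i = F N + \sum_(i < N) (F i + F (N.*2 - i)%N).
Proof.
rewrite -(big_mkord xpredT) (big_cat_nat _ (n := N)) //=; last by lia.
rewrite big_split /= big_mkord addrCA; congr (_ + _).
rewrite big_ltn; last by lia.
congr (_ + _); rewrite big_nat_rev -{1}[N.+1]add0n big_addn.
have -> : (N.*2.+1 - N.+1 = N)%N by lia.
rewrite big_mkord; apply: eq_bigr => i _; congr F; have := ltn_ord i; lia.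
Qed.

(** The terms of degrees i and 2N - i are paired, using x^(2N - i) = x^i (x^2)^(N - i). *)
Lemma palindrome_split (e : R) N f : (size f <= N.*2.+1)%N ->
  (forall i, (i < N)%N -> f`_(N.*2 - i) = e * 72%:R ^+ (N - i) * f`_i) ->
  f = f`_N *: 'X^N +
      \sum_(i < N) f`_i *: ('X^i * (1 + e *: (72%:R *: 'X^2) ^+ (N - i))).
Proof.
move=> sf fE; transitivity (\sum_(i < N.*2.+1) f`_i *: 'X^i).
  rewrite -poly_def; apply/polyP => i; rewrite coef_poly.
  by case: ltnP => // le_ni; rewrite nth_default ?(leq_trans sf).
rewrite (sum_fold (fun i => f`_i *: 'X^i)); congr (_ + _).
apply: eq_bigr => i _; rewrite (fE _ (ltn_ord i)).
have -> : (N.*2 - i = i + 2 * (N - i))%N by have := ltn_ord i; lia.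
rewrite exprD exprM exprZn -!mul_polyC !polyCM; ring.
Qed.

Lemma palindrome_homog N f : (size f <= N.*2.+1)%N ->
  (forall i, (i < N)%N -> f`_(N.*2 - i) = 72%:R ^+ (N - i) * f`_i) ->
  is_homog N f.
Proof.
move=> sf fE; rewrite (@palindrome_split 1 N f) // => [|i /fE ->]; last first.
  by rewrite mul1r.
apply: is_homogD; first exact/is_homogZ/is_homogXn.
apply: is_homog_sum => i _; apply: is_homogZ; rewrite scale1r.
rewrite -[N in is_homog N](subnKC (ltnW (ltn_ord i))).
by apply: is_homogM; [apply: is_homogXn | apply: is_homog_1Dexp].
Qed.

(** With y = 72x^2, every pair is a multiple of 1 - y^k, which is 1 - y times a geometric sum; the
    unpaired middle term must therefore vanish. *)
Lemma antipalindrome_homog N f : (size f <= N.*2.+1)%N -> f`_N = 0 ->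
  (forall i, (i < N)%N -> f`_(N.*2 - i) = - 72%:R ^+ (N - i) * f`_i) ->
  exists2 g, is_homog N.-1 g & f = (1 - 72%:R *: 'X^2) * g.
Proof.
move=> sf fN fE.
exists (\sum_(i < N) f`_i *: ('X^i * \sum_(j < N - i) (72%:R *: 'X^2) ^+ j)).
  apply: is_homog_sum => i _; apply: is_homogZ; have lt_iN := ltn_ord i.
  have [d Nid ->] : exists2 d, (N - i = d.+1)%N & (N.-1 = i + d)%N.
    by exists (N - i).-1; lia.
  rewrite Nid.
  by apply: is_homogM; [apply: is_homogXn | apply: is_homog_geometric].
rewrite {1}(@palindrome_split (- 1) N f) // => [|i /fE ->]; last first.
  by rewrite mulN1r.
rewrite fN scale0r add0r mulr_sumr; apply: eq_bigr => i _.
rewrite -scalerAr scaleN1r; congr (_ *: _).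
rewrite -[1 in LHS](expr1n _ (N - i)) subrXX mulrCA; congr (_ * (_ * _)).
by apply: eq_bigr => j _; rewrite expr1n mul1r.
Qed.

End Palindromes.

(** * Coefficients at a degree bound *)

Section TopCoefficient.

Variable R : nzRingType.
Implicit Types f g : {poly R}.

(** The value [a] may be zero: [n] is only a bound on the degree, which makes the notion stable
    under sums. *)
Definition has_top n f a := (size f <= n.+1)%N /\ f`_n = a.

Lemma has_topM m n f g a b :
  has_top m f a -> has_top n g b -> has_top (m + n) (f * g) (a * b).
Proof.
move=> [sf fm] [sg gn]; split.
  by rewrite (leq_trans (size_polyMleq _ _)) //; lia.
have lt_m : (m < (m + n).+1)%N by lia.
rewrite coefM (bigD1 (Ordinal lt_m)) //= addKn fm gn big1 ?addr0 // => j ne_jm.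
have [lt_mj|le_jm] := ltnP m j.
  by rewrite nth_default ?mul0r // (leq_trans sf).
rewrite [g`__]nth_default ?mulr0 // (leq_trans sg) //.
by move: ne_jm; rewrite -val_eqE /=; lia.
Qed.

Lemma has_topX n f a k : has_top n f a -> has_top (n * k) (f ^+ k) (a ^+ k).
Proof.
move=> fn; elim: k => [|k IHk]; last by rewrite !exprS mulnS; apply: has_topM.
by rewrite muln0; split; rewrite ?size_poly1 ?coef1.
Qed.

Lemma has_top_linear m : has_top 1 (1 + m%:R * 'X : {poly R}) m%:R.
Proof.
rewrite mulr_natl -scaler_nat.
split; last by rewrite coefD coef1 coefZ coefX add0r mulr1.
rewrite (leq_trans (size_polyD _ _)) // geq_max size_poly1.
by rewrite (leq_trans (size_scale_leq _ _)) // size_polyX.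
Qed.

Lemma has_top_sum I (r : seq I) (P : pred I) n (F : I -> {poly R}) (a : I -> R) :
  (forall i, P i -> has_top n (F i) (a i)) ->
  has_top n (\sum_(i <- r | P i) F i) (\sum_(i <- r | P i) a i).
Proof.
move=> HF; elim/big_rec2: _ => [|i b f Pi [sf fn]].
  by split; rewrite ?size_poly0 ?coef0.
have [sF Fn] := HF i Pi; split; last by rewrite coefD Fn fn.
by rewrite (leq_trans (size_polyD _ _)) // geq_max sF.
Qed.

End TopCoefficient.

(** * A polynomial solution of the second order equation modulo p *)

Section SquareRoot.

Variables (F : fieldType) (p : nat).
Hypotheses (charFp : p \in [pchar F]) (p_gt3 : (3 < p)%N).

Local Notation N := p.-1.

Lemma succ_pred_natf : N.+1%:R = 0 :> F.
Proof. by rewrite prednK ?(pcharf0 charFp) //; lia. Qed.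

Lemma natf_small_neq0 n : (0 < n < p)%N -> n%:R != 0 :> F.
Proof.
move=> /andP[n0 lt_np]; rewrite -(dvdn_pcharf charFp).
by apply/negP => /(dvdn_leq n0); lia.
Qed.

Lemma fact_natf_neq0 n : (n < p)%N -> n`!%:R != 0 :> F.
Proof.
elim: n => [|n IHn] lt_np; first by rewrite oner_eq0.
rewrite factS natrM mulf_neq0 ?IHn ?natf_small_neq0 //; lia.
Qed.

Lemma expf_natf n : n%:R != 0 :> F -> n%:R ^+ N = 1 :> F.
Proof.
move=> n0; apply: (mulfI n0); rewrite -exprS mulr1 prednK; last lia.
by rewrite -(pFrobenius_autE charFp) pFrobenius_aut_nat.
Qed.

Definition trinom k : F := (3 * k)`!%:R / k`!%:R ^+ 3.

Lemma trinomS k : (k.+1 < p)%N ->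
  k.+1%:R ^+ 2 * trinom k.+1
  = 3%:R * (3%:R * k%:R + 1) * (3%:R * k%:R + 2%:R) * trinom k.
Proof.
move=> lt_kp; have k1 : k.+1%:R != 0 :> F by rewrite natf_small_neq0.
have kf : k`!%:R != 0 :> F by rewrite fact_natf_neq0 // ltnW.
have E m : m.+1%:R = m%:R + 1 :> F by rewrite -addn1 natrD.
rewrite /trinom mulnS !addSn add0n !factS !natrM !E natrM; rewrite E in k1.
by field; rewrite kf k1.
Qed.

(* The truncation modulo [p] of [1/r * sum_k (3k)!/k!^3 z^k], with [r = 1 + 6x]
   and [z = x^2 (1 + 8x) / r^3]: the factor [1/r] becomes [r^(p - 1)]. *)
Definition sqrt_term k : {poly F} :=
  'X ^+ (2 * k) * (1 + 8%:R * 'X) ^+ k * (1 + 6%:R * 'X) ^+ (N - 3 * k).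

Definition sqrt_poly := \sum_(k < (N %/ 3).+1) trinom k *: sqrt_term k.

Lemma theta_sqrt_term k : (3 * k <= N)%N ->
  (1 + 6%:R * 'X) * theta (sqrt_term k) =
  (1 + 9%:R * 'X) * (2%:R * k%:R * (1 + 9%:R * 'X) - 6%:R * 'X * (1 + 8%:R * 'X))
  * sqrt_term k.
Proof.
move=> le_kN.
have NkE : (N - 3 * k)%:R = - 1 - 3%:R * k%:R :> {poly F}.
  have : N.+1%:R = 0 :> {poly F} by rewrite -polyC_natr succ_pred_natf.
  rewrite -{1}(subnK le_kN) -addn1 2!natrD natrM => E.
  by rewrite -[RHS]addr0 -E; ring.
have dlin m : (1 + m%:R * 'X : {poly F})^`() = m%:R.
  by rewrite derivD derivM !deriv_natr (deriv_natr _ 1) derivX; ring.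
have Ex := mul_deriv_exp ('X : {poly F}) (2 * k); rewrite derivX mulr1 natrM in Ex.
have E8 := mul_deriv_exp (1 + 8%:R * 'X : {poly F}) k; rewrite dlin in E8.
have E6 := mul_deriv_exp (1 + 6%:R * 'X : {poly F}) (N - 3 * k).
rewrite dlin NkE in E6.
rewrite /theta /sqrt_term !derivM /quad.
move: ('X^(2 * k)) ((1 + 8%:R * 'X) ^+ k) ((1 + 6%:R * 'X) ^+ _) Ex E8 E6.
move=> u v w Ex E8 E6.
transitivity ((1 + 9%:R * 'X) * ((1 + 6%:R * 'X) *
  ((1 + 8%:R * 'X) * ('X * u^`()) * v * w + 'X * u * ((1 + 8%:R * 'X) * v^`()) * w)
  + 'X * (1 + 8%:R * 'X) * u * v * ((1 + 6%:R * 'X) * w^`()))); first by ring.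
by rewrite Ex E8 E6; ring.
Qed.

(** By [trinomS], the two terms of the bracket, once multiplied by [trinom k], are neighbours in a
    telescoping sum over [k]. *)
Lemma theta2_sqrt_term k : (3 * k <= N)%N ->
  (1 + 6%:R * 'X) ^+ 2 *
    (theta (theta (sqrt_term k)) + potential F * sqrt_term k) =
  4%:R * (1 + 9%:R * 'X) ^+ 2 *
  (k%:R ^+ 2 * (1 + 6%:R * 'X) ^+ 3
   - 3%:R * (3%:R * k%:R + 1) * (3%:R * k%:R + 2%:R) * 'X ^+ 2 * (1 + 8%:R * 'X))
  * sqrt_term k.
Proof.
move=> /theta_sqrt_term; set r := 1 + 6%:R * 'X; set u := sqrt_term k.
set m := 2%:R * _ * _ - _ => E1; set l := _ * m in E1.
have dE := (deriv_natr, deriv0, derivN, derivB, oppr0, addr0).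
have Em : theta m = quad F * 'X * ((18 * k)%:R - 6%:R + 2%:R * - 48%:R * 'X).
  have -> : m = (2 * k)%:R + ((18 * k)%:R - 6%:R) * 'X + - 48%:R * 'X ^+ 2.
    by rewrite /m !natrM; ring.
  by rewrite theta_quadratic ?dE.
have E9 : theta (1 + 9%:R * 'X) = quad F * 'X * 9%:R.
  have -> : 1 + 9%:R * 'X = 1%:R + 9%:R * 'X + 0 * 'X ^+ 2 :> {poly F} by ring.
  by rewrite theta_quadratic ?dE //; ring.
have Er : theta r = quad F * 'X * 6%:R.
  have -> : r = 1%:R + 6%:R * 'X + 0 * 'X ^+ 2 :> {poly F} by rewrite /r; ring.
  by rewrite theta_quadratic ?dE //; ring.
have El : theta l = quad F * 'X * 9%:R * m +
   (1 + 9%:R * 'X) * (quad F * 'X * ((18 * k)%:R - 6%:R + 2%:R * - 48%:R * 'X)).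
  by rewrite thetaM E9 Em.
have := congr1 (@theta F) E1; rewrite thetaM [theta (l * u)]thetaM Er El => E2.
transitivity (r * (r * theta (theta u)) + r ^+ 2 * potential F * u); first by ring.
have -> : r * theta (theta u) = (quad F * 'X * 9%:R * m +
   (1 + 9%:R * 'X) * (quad F * 'X * ((18 * k)%:R - 6%:R + 2%:R * - 48%:R * 'X))) * u
   + l * theta u - quad F * 'X * 6%:R * theta u.
  by rewrite -E2; ring.
transitivity (r * (quad F * 'X * 9%:R * m +
   (1 + 9%:R * 'X) * (quad F * 'X * ((18 * k)%:R - 6%:R + 2%:R * - 48%:R * 'X))) * u
   + (l - quad F * 'X * 6%:R) * (r * theta u)
   + r ^+ 2 * potential F * u); first by ring.
by rewrite E1 /l /m /r /potential /quad natrM; ring.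
Qed.

Lemma theta2_sqrt_poly :
  theta (theta sqrt_poly) = - (potential F * sqrt_poly).
Proof.
apply/eqP; rewrite -addr_eq0; apply/eqP.
have r0 : (1 + 6%:R * 'X : {poly F}) ^+ 2 != 0.
  rewrite expf_neq0 //; apply/eqP => /(congr1 (fun f : {poly F} => f.[0])).
  by rewrite !hornerE => /eqP; rewrite oner_eq0.
apply: (mulfI r0); rewrite mulr0 /sqrt_poly !linear_sum mulr_sumr -big_split /=.
rewrite mulr_sumr.
(* The shift by 3 in the exponent gives [V k] the factor (1 + 6x)^3 and leaves [V k.+1] with the
   same power of 1 + 6x as [sqrt_term k]. *)
pose V k : {poly F} := (k%:R ^+ 2 * trinom k) *:
  ('X ^+ (2 * k) * (1 + 8%:R * 'X) ^+ k * (1 + 6%:R * 'X) ^+ (N + 3 - 3 * k)).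
transitivity (- (4%:R * (1 + 9%:R * 'X) ^+ 2) *
   \sum_(0 <= k < (N %/ 3).+1) (V k.+1 - V k)).
  rewrite big_mkord mulr_sumr; apply: eq_bigr => k _.
  have le_kN : (3 * k <= N)%N.
    by have := ltn_ord k; rewrite ltnS leq_divRL // mulnC.
  rewrite 2!linearZ /= -scalerAr -scalerDr -scalerAr theta2_sqrt_term //.
  have -> : V k.+1 = trinom k *: (3%:R * (3%:R * k%:R + 1) * (3%:R * k%:R + 2%:R)
      * 'X ^+ 2 * (1 + 8%:R * 'X) * sqrt_term k).
    rewrite /V trinomS; last by lia.
    have -> : (N + 3 - 3 * k.+1 = N - 3 * k)%N by lia.
    rewrite mulnS exprD [_ ^+ k.+1]exprS /sqrt_term -!mul_polyC.
    move: (trinom k) => t. rewrite !(polyC_natr, polyC1, polyCM, polyCD); ring.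
  have -> : V k = trinom k *: (k%:R ^+ 2 * (1 + 6%:R * 'X) ^+ 3 * sqrt_term k).
    rewrite /V; have -> : (N + 3 - 3 * k = N - 3 * k + 3)%N by lia.
    rewrite exprD /sqrt_term -!mul_polyC.
    by rewrite polyCM polyC_exp polyC_natr; ring.
  by rewrite -!mul_polyC; ring.
have -> : \sum_(0 <= k < (N %/ 3).+1) (V k.+1 - V k) = 0; last by rewrite mulr0.
have V0 : V 0 = 0 by rewrite /V mulr0n expr0n mul0r scale0r.
rewrite telescope_sumr // V0 subr0.
(* The truncation is exact: 3 (N / 3 + 1), with the quotient rounded down, is at least p, so p
   divides its factorial. *)
suff t0 : trinom (N %/ 3).+1 = 0 by rewrite /V t0 mulr0 scale0r.
apply/eqP; rewrite mulf_eq0 -(dvdn_pcharf charFp) dvdn_fact //.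
by have := divn_eq N 3; have := ltn_mod N 3; lia.
Qed.

(** Both terms of the second order equation are divisible by [quad]; cancelling it leaves an
    equation whose coefficients give a three-term recurrence. *)
Lemma sqrt_poly_rec : sqrt_poly`_1 + 6%:R * sqrt_poly`_0 = 0
 /\ (forall n, n.+2%:R ^+ 2 * sqrt_poly`_n.+2
  + (17%:R * n.+1%:R * n.+2%:R + 6%:R) * sqrt_poly`_n.+1
  + 72%:R * n.+1%:R ^+ 2 * sqrt_poly`_n = 0).
Proof.
have := theta2_sqrt_poly; set H := sqrt_poly.
have XdE (f : {poly F}) i : ('X * f^`())`_i = i%:R * f`_i.
  by case: i => [|i]; rewrite coefXM ?mul0r //= coef_deriv mulr_natl.
pose g := quad F * ('X * H^`()).
have gE : g = 'X * H^`() + 17%:R *: ('X * ('X * H^`()))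
    + 72%:R *: ('X * ('X * ('X * H^`()))).
  by rewrite /g /quad -!mul_polyC !polyC_natr; ring.
have g0 : g`_0 = 0 by rewrite gE !(coefD, coefZ, XdE, coefXM) /=; ring.
have g1 : g`_1 = H`_1.
  by rewrite gE !(coefD, coefZ, XdE, coefXM) /=; ring.
have gS n : g`_n.+2 =
    n.+2%:R * H`_n.+2 + 17%:R * n.+1%:R * H`_n.+1 + 72%:R * n%:R * H`_n.
  by rewrite gE !(coefD, coefZ, XdE, coefXM) /=; ring.
rewrite {1}/theta -mulrA => E.
have /(congr1 (fun f : {poly F} => nth 0 f)) :
    'X * g^`() + 6%:R *: ('X * H) + 72%:R *: ('X * ('X * H)) = 0.
  apply: (mulfI (quad_neq0 F)); rewrite mulr0 /g.
  have := E; rewrite /theta -[quad F * 'X * _]mulrA => E'.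
  rewrite !mulrDr E' /potential /quad -!mul_polyC !polyC_natr; ring.
move=> E'; split.
  have := congr1 (fun f => f 1%N) E'.
  rewrite !(coefD, coefZ, XdE, coefXM) /= g1 coef0 => En.
  by rewrite -[RHS]En; ring.
move=> n; have := congr1 (fun f => f n.+2) E'.
rewrite !(coefD, coefZ, XdE, coefXM) /= gS coef0 => En.
by rewrite -[RHS]En; ring.
Qed.

End SquareRoot.

(** Both sides are the coefficient of x^m in (1 + x)^m (1 - (1 + x))^m. *)
Lemma sum_signed_bin (R : comNzRingType) m :
  \sum_(k < m.+1) (- 1) ^+ k * 'C(m, k)%:R * 'C(m + k, k)%:R = (- 1) ^+ m :> R.
Proof.
have E : \sum_(k < m.+1) (- 1) ^+ k * 'C(m, k)%:R * (1 + 'X) ^+ (m + k)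
    = (1 + 'X) ^+ m * (- 'X) ^+ m :> {poly R}.
  have -> : - 'X = 1 - (1 + 'X) :> {poly R} by ring.
  rewrite exprBn mulr_sumr; apply: eq_bigr => k _.
  by rewrite expr1n exprD -mulr_natr; ring.
have := congr1 (fun f : {poly R} => f`_m) E.
have coef1X n i : ((1 + 'X : {poly R}) ^+ n)`_i = 'C(n, i)%:R.
  rewrite addrC exprD1n coef_sum.
  have [le_in|lt_ni] := leqP i n; last first.
    rewrite bin_small // big1 // => j _; rewrite coefMn coefXn.
    case: eqP => [Eij|]; last by rewrite mul0rn.
    by move: lt_ni; rewrite Eij ltnNge -ltnS ltn_ord.
  rewrite (bigD1 (Ordinal (le_in : i < n.+1)%N)) //= coefMn coefXn eqxx.
  rewrite big1 ?addr0 // => j ne_ji; rewrite coefMn coefXn.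
  by rewrite eq_sym (_ : (val j == i) = false) ?mul0rn //; apply: negPf.
have sgnE i : (- 1) ^+ i = ((- 1) ^+ i)%:P :> {poly R}.
  by rewrite polyC_exp polyCN polyC1.
rewrite /= [(- 'X) ^+ m]exprNn mulrCA sgnE coefCM coefMXn ltnn subnn.
rewrite coef1X bin0 mulr1 => <-; rewrite coef_sum; apply: eq_bigr => k _.
rewrite -[in RHS]mulrA sgnE coefCM mulr_natl coefMn coef1X.
rewrite -[_%:R *+ _]mulr_natl mulrA.
by rewrite -(bin_sub (leq_addl m k)) addnK.
Qed.

Lemma size_sqr_leq (R : nzSemiRingType) (f : {poly R}) n :
  (size f <= n.+1)%N -> (size (f ^+ 2) <= n.*2.+1)%N.
Proof.
move=> sf; rewrite (leq_trans (size_poly_exp_leq _ _)) // ltnS -muln2 leq_mul2r /=.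
by rewrite -subn1 leq_subLR add1n.
Qed.

(** * Leading coefficient and symmetry of the square root *)

Section SquareRootSymmetry.

Variables (F : fieldType) (p : nat).
Hypotheses (charFp : p \in [pchar F]) (p_gt3 : (3 < p)%N).

Local Notation N := p.-1.
Local Notation H := (sqrt_poly F p).

Lemma sqrt_poly_coef0 : H`_0 = 1.
Proof.
rewrite -horner_coef0 /sqrt_poly horner_sum (bigD1 ord0) //=.
rewrite big1 => [|k k0]; rewrite ?addr0.
  rewrite hornerZ /sqrt_term /trinom !muln0 !expr0 !mul1r horner_exp hornerD.
  rewrite hornerC hornerM hornerX mulr0 addr0 subn0 !expr1n invr1.
  by rewrite !mulr1.
have k_gt0 : (0 < 2 * k)%N by move: k0; rewrite -val_eqE /= -lt0n muln_gt0 => ->.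
rewrite hornerZ /sqrt_term !hornerM horner_exp hornerX expr0n.
by rewrite -leqn0 leqNgt k_gt0 !mul0r mulr0.
Qed.

Lemma sqrt_poly_top :
  has_top N H
    (\sum_(k < (N %/ 3).+1) trinom F k * (8%:R ^+ k * 6%:R ^+ (N - 3 * k))).
Proof.
apply: has_top_sum => k _.
have le_kN : (3 * k <= N)%N.
  by have := ltn_ord k; rewrite ltnS leq_divRL // mulnC.
have [sk ck] : has_top (2 * k + 1 * k + 1 * (N - 3 * k)) (sqrt_term F p k)
    (1 * 8%:R ^+ k * 6%:R ^+ (N - 3 * k)).
  do ![apply: has_topM | apply: has_topX | apply: has_top_linear].
  by split; rewrite ?size_polyXn ?coefXn ?eqxx.
have EN : (2 * k + 1 * k + 1 * (N - 3 * k) = N)%N by lia.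
rewrite {}EN mul1r in sk ck; split; last by rewrite coefZ ck.
exact: leq_trans (size_scale_leq _ _) sk.
Qed.

(** Since 6^N = 1, the sum has terms [trinom k] / 27^k = (1/3)_k (2/3)_k / k!^2. Modulo p the pair
    1/3, 2/3 is the pair -m, m + 1 in some order, which leads to [sum_signed_bin]. *)
Lemma sqrt_poly_lead : H`_N = (- 1) ^+ (N %/ 3).
Proof.
have [_ ->] := sqrt_poly_top; set m := (N %/ 3)%N.
have lt_mp : (m < p)%N by rewrite /m; lia.
have N1 : N%:R = - 1 :> F.
  by apply/eqP; rewrite -subr_eq0 opprK natr1 (succ_pred_natf charFp).
have n6 : 6%:R != 0 :> F.
  rewrite -(dvdn_pcharf charFp); have pr := pcharf_prime charFp.
  by rewrite (Euclid_dvdM 2 3 pr) negb_or !gtnNdvd //; lia.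
have n27 : 27%:R != 0 :> F.
  rewrite -(dvdn_pcharf charFp); have pr := pcharf_prime charFp.
  by rewrite (Euclid_dvdX 3 3 pr) gtnNdvd.
(* The left side is (3m + 1)(3m + 2), and 3m is -1 or -2 in [F] according to [N %% 3]; remainder 2
   would make 3 divide p. *)
have m_eq : 9%:R * (m%:R * (m%:R + 1)) + 2%:R = 0 :> F.
  have N3 : N%:R = m%:R * 3%:R + (N %% 3)%:R :> F.
    by rewrite {1}(divn_eq N 3) natrD natrM.
  rewrite N1 in N3.
  have pr := pcharf_prime charFp.
  have : (N %% 3 != 2)%N.
    apply/eqP => N2; have : (3 %| p)%N by rewrite -(prednK (prime_gt0 pr)); lia.
    by rewrite dvdn_prime2 //; lia.
  have := ltn_mod N 3; case: (N %% 3)%N N3 => [|[|[|]]] //= N3 _ _.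
    have -> : 9%:R * (m%:R * (m%:R + 1)) + 2%:R =
      (m%:R * 3%:R + 1) * (m%:R * 3%:R + 2%:R) :> F by ring.
    by move: N3; rewrite addr0 => <-; ring.
  have -> : 9%:R * (m%:R * (m%:R + 1)) + 2%:R =
     (m%:R * 3%:R + 1 + 1) * (m%:R * 3%:R + 1) :> F by ring.
  by rewrite -N3; ring.
rewrite -(sum_signed_bin F m); apply: eq_bigr => k _.
have le_km : (k <= m)%N by rewrite -ltnS.
have le_kN : (3 * k <= N)%N by rewrite mulnC -leq_divRL.
have -> : 8%:R ^+ k * 6%:R ^+ (N - 3 * k) = 27%:R ^- k :> F.
  have -> : 8%:R ^+ k = (6%:R ^+ 3) ^+ k * 27%:R ^- k :> F.
    by rewrite -exprVn -exprMn; congr (_ ^+ _); field.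
  by rewrite -exprM mulrAC -exprD subnKC // (expf_natf charFp p_gt3 n6) mul1r.
apply: (canLR (mulfK (expf_neq0 k n27))).
elim: (nat_of_ord k) le_km => [|j IHj] lt_jm.
  by rewrite /trinom muln0 !expr0 expr1n !bin0 divr1 !mulr1.
have lt_jp : (j.+1 < p)%N by apply: leq_ltn_trans lt_jm lt_mp.
have j1 : j.+1%:R ^+ 2 != 0 :> F.
  by rewrite expf_neq0 // (natf_small_neq0 charFp p_gt3).
apply: (mulfI j1); rewrite (trinomS charFp p_gt3 lt_jp) (IHj (ltnW lt_jm)).
have E1 : j.+1%:R * 'C(m, j.+1)%:R = (m%:R - j%:R) * 'C(m, j)%:R :> F.
  by rewrite -natrM mul_bin_left natrM natrB // ltnW.
have E2 : j.+1%:R * 'C(m + j.+1, j.+1)%:R =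
    (m%:R + j%:R + 1) * 'C(m + j, j)%:R :> F.
  by rewrite addnS -natrM -mul_bin_diag natrM -natr1 natrD.
rewrite ![_ ^+ j.+1]exprS.
transitivity (- (- 1) ^+ j * (j.+1%:R * 'C(m, j.+1)%:R) *
  (j.+1%:R * 'C(m + j.+1, j.+1)%:R) * 27%:R ^+ j * 27%:R : F); last by ring.
rewrite E1 E2.
move: ('C(m, j)%:R : F) ('C(m + j, j)%:R : F) ((- 1) ^+ j) (27%:R ^+ j) => x y s t.
transitivity (s * x * y * t * (- (27%:R * (m%:R - j%:R) * (m%:R + j%:R + 1))
  + 3%:R * (9%:R * (m%:R * (m%:R + 1)) + 2%:R))); first by ring.
by rewrite m_eq; ring.
Qed.

(** As N = -1 in [F], replacing n by N - n is n -> -1 - n, which maps the recurrence to itself up to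
    powers of 72. Two consecutive cases are carried through the induction. *)
Lemma sqrt_poly_palindrome j :
  (j <= N)%N -> 72%:R ^+ j * H`_(N - j) = H`_N * H`_j.
Proof.
have [r0 rS] := sqrt_poly_rec charFp p_gt3; have h0 := sqrt_poly_coef0.
have N1 : N%:R = - 1 :> F.
  by apply/eqP; rewrite -subr_eq0 opprK natr1 (succ_pred_natf charFp).
have [n NE] : exists n, N = n.+1 by exists N.-1; lia.
suff [] : ((j <= N)%N -> 72%:R ^+ j * H`_(N - j) = H`_N * H`_j) /\
    ((j.+1 <= N)%N -> 72%:R ^+ j.+1 * H`_(N - j.+1) = H`_N * H`_j.+1) by [].
elim: j => [|j [IH1 IH2]].
  split=> _; first by rewrite expr0 subn0 mul1r h0 mulr1.
  have nE : n = (N - 1)%N by lia.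
  have := rS n; rewrite -NE (succ_pred_natf charFp p_gt3) N1 nE.
  have -> : H`_1 = - (6%:R * H`_0) by apply/eqP; rewrite -addr_eq0 r0.
  rewrite h0; move: (H`_(N - 1)) (H`_N) (H`_N.+1) => x y z E.
  by apply/eqP; rewrite -subr_eq0; apply/eqP; rewrite -[RHS]E; ring.
split=> // lt_jN.
have j2 : j.+2%:R ^+ 2 != 0 :> F.
  by rewrite expf_neq0 // (natf_small_neq0 charFp) //; lia.
apply: (mulfI j2).
have jN (i : nat) : (i <= N)%N -> (N - i)%:R = - 1 - i%:R :> F.
  by move=> le_iN; rewrite natrB // N1.
have := rS (N - j.+2)%N.
rewrite (subnSK lt_jN) (subnSK (ltnW lt_jN)).
rewrite !jN; [|lia..] => rev_rec.
move: (rS j) (IH1 (ltnW (ltnW lt_jN))) (IH2 (ltnW lt_jN)) rev_rec.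
move: (H`_(N - j)) (H`_(N - j.+1)) (H`_(N - j.+2)) (H`_N) => a b c h.
move: (H`_j) (H`_j.+1) (H`_j.+2) => x y z.
rewrite ![72%:R ^+ _.+1]exprS -[j.+2]addn2 -[j.+1]addn1 !natrD => E Ea Eb E'.
transitivity (h * ((j%:R + 2%:R) ^+ 2 * z)); last by ring.
have -> : (j%:R + 2%:R) ^+ 2 * z =
    - ((17%:R * (j%:R + 1) * (j%:R + 2%:R) + 6%:R) * y
       + 72%:R * (j%:R + 1) ^+ 2 * x).
  by apply/eqP; rewrite -addr_eq0 -E; apply/eqP; ring.
transitivity (- ((17%:R * (j%:R + 1) * (j%:R + 2%:R) + 6%:R) * (h * y)
  + 72%:R * (j%:R + 1) ^+ 2 * (h * x))); last by ring.
rewrite -Ea -Eb; apply/eqP; rewrite -addr_eq0; apply/eqP.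
rewrite -[RHS](mulr0 (72%:R * 72%:R ^+ j)) -E'.
ring.
Qed.

(** Uniqueness: both homogenizations are annihilated by [sym_op], and both polynomials have constant
    coefficient 1. *)
Lemma sqr_eq_homog_apery (f : {poly F}) : (size f <= p)%N -> H ^+ 2 = homog N f ->
  f = \poly_(n < p) (apery n)%:R.
Proof.
move=> sf Hf; have NE : N.+1 = p by rewrite prednK //; lia.
have f0 : f`_0 = 1.
  rewrite -(@coef_homog_low _ N f 0) // -Hf -horner_coef0 horner_exp horner_coef0.
  by rewrite sqrt_poly_coef0 expr1n.
have nz n : (0 < n <= N)%N -> n%:R != 0 :> F.
  by move=> nN; apply: (natf_small_neq0 charFp); lia.
have eq0 : (f - \poly_(n < p) (apery n)%:R)`_0 = 0.
  rewrite coefB f0 coef_poly /apery; case: ifP => [_|]; last by lia.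
  by rewrite big_nat1 !bin0 exp1n muln1 subrr.
have sym0 : sym_op (homog N (f - \poly_(n < p) (apery n)%:R)) = 0.
  rewrite !linearB /= -Hf (sym_op_sqr (theta2_sqrt_poly charFp p_gt3)) sub0r.
  by rewrite -[X in \poly_(_ < X) _]NE sym_op_apery ?oppr0 // (succ_pred_natf charFp).
apply/eqP; rewrite -subr_eq0; apply/eqP/polyP => n; rewrite coef0.
have [lt_np|le_pn] := ltnP n p.
  by apply: (homog_sym_op_eq0 nz eq0 sym0); lia.
by rewrite coefB coef_poly ltnNge le_pn /= subr0 nth_default // (leq_trans sf).
Qed.

Lemma apery_square_dichotomy M (e : F) : N = M.*2 -> H`_N = e * 72%:R ^+ M ->
  (e = 1 -> exists B : {poly F}, \poly_(n < p) (apery n)%:R = B ^+ 2) /\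
  (e = - 1 -> exists B : {poly F},
    \poly_(n < p) (apery n)%:R = ('X^2 - 34%:R *: 'X + 1) * B ^+ 2).
Proof.
move=> NM eE; have [sH _] := sqrt_poly_top; rewrite NM in sH eE.
have n72 : 72%:R != 0 :> F.
  rewrite -(dvdn_pcharf charFp); have pr := pcharf_prime charFp.
  rewrite (_ : 72 = 2 ^ 3 * 3 ^ 2)%N // Euclid_dvdM // !Euclid_dvdX //.
  by rewrite !gtnNdvd //; lia.
have pal j : (j <= M)%N -> H`_(M.*2 - j) = e * 72%:R ^+ (M - j) * H`_j.
  move=> le_jM; apply: (mulfI (expf_neq0 j n72)).
  have := @sqrt_poly_palindrome j; rewrite NM eE => ->; last lia.
  by rewrite -{1}(subnKC le_jM) exprD; ring.
split=> eV; rewrite {e}eV in eE pal.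
  have [|B sB HB] := @palindrome_homog F M H sH.
    by move=> i lt_iM; rewrite pal 1?ltnW // mul1r.
  exists B; apply/esym/sqr_eq_homog_apery.
    by rewrite (leq_trans (size_sqr_leq sB)) // -NM prednK //; lia.
  by rewrite HB !expr2 homogM // NM addnn.
have [||K [B sB KB] HK] := @antipalindrome_homog F M H sH.
(* At the middle index antisymmetry says that the coefficient is its own opposite, and 2 is
   invertible. *)
- have := pal M (leqnn M); rewrite subnn expr0 mulr1 mulN1r -addnn addnK.
  move/eqP; rewrite -addr_eq0 -mulr2n -mulr_natl mulf_eq0.
  have n2 : 2%:R != 0 :> F by apply: (natf_small_neq0 charFp p_gt3); lia.
  by rewrite (negPf n2) => /eqP.
- by move=> i lt_iM; rewrite pal 1?ltnW // mulN1r mulNr.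
have M_gt0 : (0 < M)%N by lia.
have sB2 : (size (B ^+ 2) <= M.-1.*2.+1)%N.
  exact: size_sqr_leq.
have sD : (size ('X^2 - 34%:R *: 'X + 1 : {poly F})%R <= 3)%N.
  rewrite !(leq_trans (size_polyD _ _)) // geq_max size_poly1 andbT.
  rewrite (leq_trans (size_polyD _ _)) // geq_max size_polyXn size_polyN /=.
  by rewrite (leq_trans (size_scale_leq _ _)) // size_polyX.
(* Here ([quad] - 17x)^2 - 288x^2 = (1 + 72x^2)^2 - 4 * 72x^2. *)
have hD : homog 2 ('X^2 - 34%:R *: 'X^1 + 'X^0) =
    (1 - 72%:R *: 'X^2) ^+ 2 :> {poly F}.
  rewrite !(linearD, linearN, linearZ) /= !homogXn // /quad.
  by rewrite -!mul_polyC !polyC_natr !subSS subn0 expr0 expr1; ring.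
exists B; apply/esym/sqr_eq_homog_apery.
  apply: leq_trans (size_polyMleq _ _) _.
  rewrite -subn1 leq_subLR (leq_trans (leq_add sD sB2)) //.
  by move: M_gt0 NM p_gt3; lia.
have -> : N = (2 + (M.-1 + M.-1))%N by move: M_gt0 NM; lia.
rewrite -homogM ?addnn // HK KB exprMn -hD expr1 expr0; congr (_ * _).
by rewrite expr2 homogM // addnn expr2.
Qed.

End SquareRootSymmetry.

(** * The quadratic character of 2 *)

Section TwoPower.

Variables (F : fieldType) (p : nat).
Hypotheses (charFp : p \in [pchar F]) (p_gt2 : (2 < p)%N).

(* For a matrix [J] with [J ^ 2 = -1], the identity [(1 + J) ^ 2 = 2 J] and the
   Frobenius morphism give [1 + J ^ p = (1 + J) (2 J) ^ (p./2)]. *)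
Lemma two_pow_half : 2%:R ^+ p./2 = (- 1) ^+ ((p %% 8)%N \in [:: 3; 5]%N) :> F.
Proof.
(* The quarter-turn matrix serves as a square root of -1 even if [F] has none. All matrices below
   have the form a + bJ, and entry [0 0] reads off a. *)
have [J [J2 J00]] : exists J : 'M[F]_2, J ^+ 2 = - 1 /\ J 0 0 = 0.
  exists (\matrix_(i, j) ((i == 1) && (j == 0))%:R
          - \matrix_(i, j) ((i == 0) && (j == 1))%:R).
  split; last by rewrite !mxE /= subrr.
  apply/matrixP => i j; rewrite expr2 !mxE !big_ord_recr big_ord0 /= !mxE.
  by case: i => [[|[|]]] //= ?; case: j => [[|[|]]] //= ?; rewrite /=; ring.
have J3 : J ^+ 3 = - J by rewrite exprS J2 mulrN1.
have J4 : J ^+ 4 = 1 by rewrite (exprM J 2 2) J2 sqrrN expr1n.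
have Jmod n : J ^+ n = J ^+ (n %% 4).
  by rewrite {1}(divn_eq n 4) exprD mulnC exprM J4 expr1n mul1r.
have charM : p \in [pchar 'M[F]_2].
  rewrite inE (pcharf_prime charFp) /=; apply/eqP.
  by rewrite -scaler_nat (pcharf0 charFp) scale0r.
have p_odd : odd p by case: (even_prime (pcharf_prime charFp)) => // p2; lia.
have E : 1 + J ^+ p = (1 + J) * J ^+ p./2 *+ 2 ^ p./2.
  have := pFrobenius_autD_comm charM (commr_sym (commr1 J)).
  rewrite !pFrobenius_autE expr1n => <-.
  rewrite -{1}(odd_double_half p) p_odd exprS -mul2n exprM -mulrnAr -exprMn_n.
  congr (_ * _ ^+ _).
  rewrite expr2 mulrDl mul1r mulrDr mulr1 -expr2 J2 [1 + J]addrC addrACA.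
  by rewrite subrr addr0 mulr2n.
have := congr1 (fun A : 'M_2 => A 0 0) E.
rewrite (Jmod p) (Jmod p./2) -scaler_nat natrX.
have : (p %% 8 \in [:: 1; 3; 5; 7])%N by rewrite !inE; lia.
rewrite !inE; case/or4P => /eqP r8; rewrite r8 /=.
- have -> : (p %% 4 = 1)%N by lia.
  have -> : (p./2 %% 4 = 0)%N by lia.
  by rewrite !expr1 !expr0 mulr1 !mxE /= !J00 !addr0 mulr1.
- have -> : (p %% 4 = 3)%N by lia.
  have -> : (p./2 %% 4 = 1)%N by lia.
  rewrite J3 expr1 mulrDl mul1r -expr2 J2 !mxE J00 /= subr0 sub0r mulrN1 => c.
  by rewrite -[LHS]opprK -c.
- have -> : (p %% 4 = 1)%N by lia.
  have -> : (p./2 %% 4 = 2)%N by lia.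
  rewrite expr1 J2 mulrN1 !mxE J00 /= addr0 mulrN1 => c.
  by rewrite -[LHS]opprK -c.
- have -> : (p %% 4 = 3)%N by lia.
  have -> : (p./2 %% 4 = 3)%N by lia.
  rewrite J3 mulrN mulrDl mul1r -expr2 J2 !mxE J00 /= subr0 sub0r opprK.
  by rewrite mulr1 => <-.
Qed.

End TwoPower.

(** * The sign of the symmetry modulo 24, and the conclusion *)

Theorem theorem2 (p : nat) (p_prime : prime p)
    (p_mod : (p %% 24)%N \in [:: 1; 5; 7; 11; 13; 17; 19; 23]%N) :
  exists B : {poly 'F_p},
    ((p %% 24)%N \in [:: 1; 5; 7; 11]%N -> apery_poly p = B ^+ 2) /\
    ((p %% 24)%N \in [:: 13; 17; 19; 23]%N ->
       apery_poly p = ('X^2 - 34%:R *: 'X + 1) * B ^+ 2).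
Proof.
have p_gt3 : (3 < p)%N.
  by move: p_mod (prime_gt1 p_prime); rewrite !inE; lia.
have charFp := pchar_Fp p_prime.
have n6 : 6%:R != 0 :> 'F_p.
  rewrite -(dvdn_pcharf charFp) (Euclid_dvdM 2 3 p_prime) negb_or.
  by rewrite !gtnNdvd //; lia.
have p_half : p.-1 = (p./2).*2.
  have : odd p; last by lia.
  by rewrite -(prednK (prime_gt0 p_prime)); move: p_mod; rewrite !inE; lia.
have e72 : 72%:R ^+ p./2 = 2%:R ^+ p./2 :> 'F_p.
  have -> : 72%:R = (2 * 6 ^ 2)%:R :> 'F_p by [].
  rewrite natrM exprMn natrX -exprM mul2n -p_half.
  by rewrite (expf_natf charFp p_gt3 n6) mulr1.
have lead : (sqrt_poly 'F_p p)`_p.-1 =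
    (- 1) ^+ ((p %% 24)%N \notin [:: 1; 5; 7; 11]%N) * 72%:R ^+ p./2.
  rewrite e72 (two_pow_half charFp) ?(ltnW p_gt3) //.
  rewrite (sqrt_poly_lead charFp p_gt3).
  (* What remains is a parity statement: the parity of [p.-1 %/ 3] and the residue of p modulo 8 are
     both determined by p modulo 24. *)
  rewrite -signr_addb -signr_odd; congr (_ ^+ nat_of_bool _).
  move: p_mod; rewrite !inE; lia.
have [dich1 dichN1] := apery_square_dichotomy charFp p_gt3 p_half lead.
have [good|bad] := boolP ((p %% 24)%N \in [:: 1; 5; 7; 11]%N).
  have [|B AB] := dich1; first by rewrite good.
  by exists B; split=> // p_bad; move: good p_bad; rewrite !inE; lia.
have [|B AB] := dichN1; first by rewrite bad.
by exists B; split=> // good; rewrite good in bad.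
Qed.
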